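(* Let $m=\sqrt{(s_0-t_0)(s_1-t_1)}$, and put $$T(\mathrm{OD})=\frac{\sqrt{s_0s_1}\,ut_1^2}{s_1^2}(\cosh_q(mu)-1)+\frac{(s_1-t_1)m}{(s_0-t_0)\sqrt{s_0s_1}}\big(\sinh_D(mu;q)-mu\big)+\frac{2t_1(s_1-t_1)\sqrt{s_0s_1}}{s_1^2m}\big(\sinh_q(mu)-mu\big),$$ $$T(\mathrm{ED})=\frac{2t_1}{s_1}(\cosh_q(mu)-1)+\frac{ut_1^2(s_0-t_0)\sqrt{s_0s_1}}{s_1^2s_0m}\sinh_q(mu)+\frac{(s_1-t_1)}{t_1}\big(\cosh_D(mu;q)-1\big).$$ Then $$\mathcal{D}_0(s_0,s_1,t_0,t_1,q,u)=\frac{\frac{1}{s_0}\big[T(\mathrm{ED})\big(s_1-t_1\cosh_q(mu)\big)\big]+T(\mathrm{OD})\Big(\frac{t_1(s_0-t_0)\sqrt{s_0s_1}}{ms_0}\sinh_q(mu)\Big)}{s_0s_1-(s_0t_1+s_1t_0)\cosh_q(mu)+t_0t_1\,\mathrm{e}_q(mu)\,\mathrm{e}_q(-mu)},$$ $$\mathcal{D}_1(s_0,s_1,t_0,t_1,q,u)=\frac{\frac{s_1\sqrt{s_1}\,T(\mathrm{OD})}{\sqrt{s_0}}\big(s_0-t_0\cosh_q(mu)\big)+T(\mathrm{ED})\Big(\frac{s_1t_0(s_1-t_1)}{m}\sinh_q(mu)\Big)}{s_0s_1-(s_0t_1+s_1t_0)\cosh_q(mu)+t_0t_1\,\mathrm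{e}_q(mu)\,\mathrm{e}_q(-mu)}.$$
   Context: $\mathfrak{B}_n$ is the group of permutations $w$ of $\{\pm1,\dots,\pm n\}$ with $w(-i)=-w(i)$, written $w=w_1,\dots,w_n$ with $w_i=w(i)$; $\mathfrak{D}_n\subseteq\mathfrak{B}_n$ is the subgroup of those $w$ with an even number of negative entries among $w_1,\dots,w_n$. For $w\in\mathfrak{D}_n$ set $w_{-1}=-w_1$; an index $i\in\{-1,1,2,\dots,n-1\}$ is a descent if $w_i>w_{|i|+1}$ and an ascent if $w_i<w_{|i|+1}$. $\mathrm{odes}_D(w),\mathrm{edes}_D(w)$ are the numbers of odd, resp. even, descents and $\mathrm{oasc}_D(w),\mathrm{easc}_D(w)$ the numbers of odd, resp. even, ascents; the index $-1$ is odd. The type D inversion number is $\mathrm{inv}_D(w)=|\{1\le i<j\le n:w_i>w_j\}|+|\{1\le i<j\le n:-w_i>w_j\}|$. Define $D_n(s_0,s_1,t_0,t_1,q)=\sum_{w\in\mathfrak{D}_n}s_0^{\mathrm{easc}_D(w)}s_1^{\mathrm{oasc}_D(w)}t_0^{\mathrm{edes}_D(w)}t_1^{\mathrm{odes}_D(w)}q^{\mathrm{inv}_D(w)}$, $D_n(1,q)=\sum_{w\in\mathfrak{D}_n}q^{\mathrm{inv}_D(w)}$ (so $D_0(1,q)=D_1(1,q)=1$), and $$\mathcal{D}_0(s_0,s_1,t_0,t_1,q,u)=\sum_{k\ge1}D_{2k}(s_0,s_1,t_0,t_1,q)\frac{u^{2k}}{D_{2k}(1,q)},\quad \mathcal{D}_1(s_0,s_1,t_0,t_1,q,u)=\sum_{k\ge1}D_{2k+1}(s_0,s_1,t_0,t_1,q)\frac{u^{2k+1}}{D_{2k+1}(1,q)}.$$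 $[j]_q=1+q+\cdots+q^{j-1}$, $[n]_q!=\prod_{j=1}^n[j]_q$, $\mathrm{e}_q(u)=\sum_{n\ge0}u^n/[n]_q!$, $\cosh_q(u)=\frac{\mathrm{e}_q(u)+\mathrm{e}_q(-u)}2$, $\sinh_q(u)=\frac{\mathrm{e}_q(u)-\mathrm{e}_q(-u)}2$; $\exp_D(u;q)=\sum_{n\ge0}u^n/D_n(1,q)$, $\cosh_D(u;q)=\frac{\exp_D(u;q)+\exp_D(-u;q)}2$, $\sinh_D(u;q)=\frac{\exp_D(u;q)-\exp_D(-u;q)}2$.
   Formalization: Corrected coefficients: T(OD) sinh_D term is multiplied by s0/s1; T(ED) u·sinh_q term by √(s0s1); T(ED) cosh_D term has (s1-t1)/s1, not (s1-t1)/t1; in D_0 the prefactor 1/s0 becomes s1 and the T(OD) term is multiplied by s1. Here √(s0s1)=√s0·√s1; denominators are nonzero. *)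

(* Defs.v *)
From HB Require Import structures.
From mathcomp Require Import all_boot all_order all_fingroup all_algebra.
From mathcomp Require Import boolp.

Set Implicit Arguments.
Unset Strict Implicit.
Unset Printing Implicit Defensive.

Import Order.TTheory GRing.Theory Num.Theory.
Local Open Scope ring_scope.

(** * Formal power series in one variable [u] over a field *)

(* A wrapper rather than a bare [nat -> K]: the latter already carries the
   pointwise ring structure. *)
Record fps (K : Type) := Fps { fcoef : nat -> K }.

HB.instance Definition _ (K : Type) := gen_eqMixin (fps K).
HB.instance Definition _ (K : Type) := gen_choiceMixin (fps K).

Section FpsRing.
Variable K : fieldType.
Implicit Types (f g h : fps K) (a b : K) (n : nat).

Lemma fpsP f g : (forall n, fcoef f n = fcoef g n) -> f = g.
Proof. by case: f g => [f] [g] /= fg; congr Fps; apply/funext. Qed.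

Definition fps_zero : fps K := Fps (fun=> 0).
Definition fps_opp f := Fps (fun n => - fcoef f n).
Definition fps_add f g := Fps (fun n => fcoef f n + fcoef g n).

Fact fps_addA : associative fps_add.
Proof. by move=> f g h; apply/fpsP => n /=; rewrite addrA. Qed.
Fact fps_addC : commutative fps_add.
Proof. by move=> f g; apply/fpsP => n /=; rewrite addrC. Qed.
Fact fps_add0 : left_id fps_zero fps_add.
Proof. by move=> f; apply/fpsP => n /=; rewrite add0r. Qed.
Fact fps_addN : left_inverse fps_zero fps_opp fps_add.
Proof. by move=> f; apply/fpsP => n /=; rewrite addNr. Qed.

HB.instance Definition _ :=
  GRing.isZmodule.Build (fps K) fps_addA fps_addC fps_add0 fps_addN.

Definition fps_one : fps K := Fps (fun n => (n == 0)%:R).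
Definition fps_mul f g :=
  Fps (fun n => \sum_(i < n.+1) fcoef f i * fcoef g (n - i)%N).

Definition fps_trunc n f : {poly K} := \poly_(i < n.+1) fcoef f i.

Lemma coef_fps_trunc n f i : (i <= n)%N -> (fps_trunc n f)`_i = fcoef f i.
Proof. by move=> le_in; rewrite coef_poly ltnS le_in. Qed.

Lemma fps_mulE n f g i : (i <= n)%N ->
  fcoef (fps_mul f g) i = (fps_trunc n f * fps_trunc n g)`_i.
Proof.
move=> le_in; rewrite coefM /=; apply: eq_bigr => j _.
by rewrite !coef_fps_trunc ?(leq_trans (leq_subr _ _)) // (leq_trans _ le_in)
           // -ltnS.
Qed.

Fact fps_mulC : commutative fps_mul.
Proof. by move=> f g; apply/fpsP => n; rewrite !(@fps_mulE n) // mulrC. Qed.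

Fact fps_mulA : associative fps_mul.
Proof.
move=> f g h; apply/fpsP => n.
rewrite [LHS](_ : _ = (fps_trunc n f * (fps_trunc n g * fps_trunc n h))`_n).
  rewrite mulrA [LHS]coefM; apply: eq_bigr => i _.
  have le_in : (i <= n)%N by rewrite -ltnS.
  by rewrite (fps_mulE _ _ le_in) coef_fps_trunc ?leq_subr.
rewrite [RHS]coefM; apply: eq_bigr => i _.
have le_in : (i <= n)%N by rewrite -ltnS.
by rewrite (fps_mulE _ _ (leq_subr i n)) coef_fps_trunc.
Qed.

Fact fps_mul1 : left_id fps_one fps_mul.
Proof.
move=> f; apply/fpsP => n /=.
rewrite big_ord_recl /= mul1r subn0 big1 ?addr0 // => i _.
by rewrite mul0r.
Qed.

Fact fps_mulDl : left_distributive fps_mul fps_add.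
Proof.
move=> f g h; apply/fpsP => n /=; rewrite -big_split /=.
by apply: eq_bigr => i _; rewrite mulrDl.
Qed.

Fact fps_one_neq0 : fps_one != 0.
Proof.
apply/eqP => /(congr1 (fun f => fcoef f 0)) /= /eqP.
by rewrite oner_eq0.
Qed.

HB.instance Definition _ := GRing.Zmodule_isComNzRing.Build (fps K)
  fps_mulA fps_mulC fps_mul1 fps_mulDl fps_one_neq0.

Definition fps_scale a f := Fps (fun n => a * fcoef f n).

Fact fps_scaleA a b f : fps_scale a (fps_scale b f) = fps_scale (a * b) f.
Proof. by apply/fpsP => n /=; rewrite mulrA. Qed.
Fact fps_scale1 : left_id 1 fps_scale.
Proof. by move=> f; apply/fpsP => n /=; rewrite mul1r. Qed.
Fact fps_scaleDr : right_distributive fps_scale +%R.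
Proof. by move=> a f g; apply/fpsP => n /=; rewrite mulrDr. Qed.
Fact fps_scaleDl f : {morph fps_scale^~ f : a b / a + b}.
Proof. by move=> a b; apply/fpsP => n /=; rewrite mulrDl. Qed.

HB.instance Definition _ := GRing.Zmodule_isLmodule.Build K (fps K)
  fps_scaleA fps_scale1 fps_scaleDr fps_scaleDl.

Fact fps_scaleAl a f g : a *: (f * g) = a *: f * g.
Proof.
apply/fpsP => n /=; rewrite mulr_sumr.
by apply: eq_bigr => i _; rewrite mulrA.
Qed.

HB.instance Definition _ :=
  GRing.Lmodule_isLalgebra.Build K (fps K) fps_scaleAl.
HB.instance Definition _ := GRing.Lalgebra_isComAlgebra.Build K (fps K).

Definition fps_unit : pred (fps K) := fun f => fcoef f 0 != 0.

(* The first [n] coefficients [g_0, ..., g_(n-1)] of the inverse of [f]. *)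
Fixpoint fps_inv_seq f n : seq K :=
  if n is k.+1 then
    let s := fps_inv_seq f k in
    rcons s (((k == 0)%:R - \sum_(i < k) fcoef f (k - i)%N * s`_i) / fcoef f 0)
  else [::].

Definition fps_inv f : fps K :=
  if fcoef f 0 != 0 then Fps (fun n => (fps_inv_seq f n.+1)`_n) else f.

Lemma size_fps_inv_seq f n : size (fps_inv_seq f n) = n.
Proof. by elim: n => //= n IHn; rewrite size_rcons IHn. Qed.

Lemma nth_fps_inv_seq f n i : (i < n)%N ->
  (fps_inv_seq f n)`_i = (fps_inv_seq f i.+1)`_i.
Proof.
elim: n => // n IHn; rewrite ltnS leq_eqVlt => /predU1P[-> //|lt_in].
by rewrite -(IHn lt_in) /= nth_rcons size_fps_inv_seq lt_in.
Qed.

Fact fps_mulVx : {in fps_unit, left_inverse 1 fps_inv *%R}.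
Proof.
move=> f f0; apply/fpsP => n.
have {}f0 : fcoef f 0 != 0 := f0.
rewrite /fps_inv f0 /= big_ord_recr /= subnn nth_rcons size_fps_inv_seq.
rewrite ltnn eqxx divfK // addrC -[RHS](addrNK
  (\sum_(i < n) fcoef f (n - i)%N * (fps_inv_seq f n)`_i)); congr (_ + _).
apply: eq_bigr => i _; rewrite mulrC; congr (_ * _).
by rewrite (nth_fps_inv_seq f (ltn_ord i)).
Qed.

Fact fps_unitP f g : g * f = 1 -> fps_unit f.
Proof.
move=> /(congr1 (fun h => fcoef h 0)) /=; rewrite big_ord1 subnn => gf1.
rewrite /fps_unit; apply: contra_eq_neq gf1 => ->.
by rewrite mulr0 eq_sym oner_neq0.
Qed.

Fact fps_inv_out : {in [predC fps_unit], fps_inv =1 id}.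
Proof. by move=> f f0; rewrite /fps_inv ifN. Qed.

HB.instance Definition _ := GRing.ComNzRing_hasMulInverse.Build (fps K)
  fps_mulVx fps_unitP fps_inv_out.

Definition fpsX : fps K := Fps (fun n => (n == 1)%:R).

End FpsRing.

Arguments fpsX {K}.

(** * Signed permutations *)

(* [(i, b) : signed n] stands for the element [(-1)^b (i+1)] of
   {1, -1, ..., n, -n}. *)
Notation signed n := ('I_n * bool)%type.

Definition sval_int n (x : signed n) : int := (-1) ^+ x.2 * (x.1.+1)%:Z.

Definition sopp n (x : signed n) : signed n := (x.1, ~~ x.2).

Definition Bgroup n : {set {perm signed n}} :=
  [set w : {perm signed n} | [forall x, w (sopp x) == sopp (w x)]].

Definition window n (w : {perm signed n}) : seq int :=
  [seq sval_int (w (i, false)) | i <- enum 'I_n].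

(* [w_i] with 1-based positive index, and [w_(-i) = - w_i] (only [w_(-1)] is
   used below). *)
Definition wentry n (w : {perm signed n}) (i : int) : int :=
  match i with
  | Posz k => (window w)`_k.-1
  | Negz k => - (window w)`_k
  end.

Definition Dgroup n : {set {perm signed n}} :=
  [set w in Bgroup n | ~~ odd (count (fun x : int => x < 0) (window w))].

(* -1, 1, 2, ..., n-1; the filter only matters for n <= 1, where it discards
   the index -1, for which [w_2] does not exist. *)
Definition Dindices (n : nat) : seq int :=
  [seq i <- (-1 : int) :: [seq i%:Z | i <- iota 1 n.-1] | (`|i| < n)%N].

Section Statistics.
Variables (n : nat) (w : {perm signed n}).

Definition Ddescent (i : int) : bool := wentry w (`|i|.+1)%N < wentry w i.
Definition Dascent (i : int) : bool := wentry w i < wentry w (`|i|.+1)%N.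

Definition odesD := count (fun i : int => odd `|i|%N && Ddescent i) (Dindices n).
Definition edesD := count (fun i : int => ~~ odd `|i|%N && Ddescent i) (Dindices n).
Definition oascD := count (fun i : int => odd `|i|%N && Dascent i) (Dindices n).
Definition eascD := count (fun i : int => ~~ odd `|i|%N && Dascent i) (Dindices n).

Definition invD : nat :=
  (#|[set ij : 'I_n * 'I_n | (ij.1 < ij.2)%N &
        ((window w)`_ij.2 < (window w)`_ij.1)%R]| +
   #|[set ij : 'I_n * 'I_n | (ij.1 < ij.2)%N &
        ((window w)`_ij.2 < - (window w)`_ij.1)%R]|)%N.

End Statistics.

(** * Generating functions *)

Section GeneratingFunctions.
Variable K : fieldType.

Definition Dpoly (n : nat) (s0 s1 t0 t1 q : K) : K :=
  \sum_(w in Dgroup n)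
    s0 ^+ eascD w * s1 ^+ oascD w * t0 ^+ edesD w * t1 ^+ odesD w * q ^+ invD w.

Definition Dcount (n : nat) (q : K) : K := \sum_(w in Dgroup n) q ^+ invD w.

(* \mathcal{D}_0 and \mathcal{D}_1: even n = 2k and odd n = 2k + 1, both with
   k >= 1. *)
Definition Dgf0 (s0 s1 t0 t1 q : K) : fps K :=
  Fps (fun n => if (2 <= n)%N && ~~ odd n
                then Dpoly n s0 s1 t0 t1 q / Dcount n q else 0).

Definition Dgf1 (s0 s1 t0 t1 q : K) : fps K :=
  Fps (fun n => if (3 <= n)%N && odd n
                then Dpoly n s0 s1 t0 t1 q / Dcount n q else 0).

Definition qint (j : nat) (q : K) : K := \sum_(i < j) q ^+ i.
Definition qfact (n : nat) (q : K) : K := \prod_(1 <= j < n.+1) qint j q.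

(* The six series below are e_q(c u), ..., sinh_D(c u; q) as series in u. *)
Definition e_q (q c : K) : fps K := Fps (fun n => c ^+ n / qfact n q).
Definition cosh_q (q c : K) : fps K := 2^-1 *: (e_q q c + e_q q (- c)).
Definition sinh_q (q c : K) : fps K := 2^-1 *: (e_q q c - e_q q (- c)).

Definition exp_D (q c : K) : fps K := Fps (fun n => c ^+ n / Dcount n q).
Definition cosh_D (q c : K) : fps K := 2^-1 *: (exp_D q c + exp_D q (- c)).
Definition sinh_D (q c : K) : fps K := 2^-1 *: (exp_D q c - exp_D q (- c)).

End GeneratingFunctions.

(* Main.v *)
Require Import Defs.
From HB Require Import structures.
From mathcomp Require Import all_boot all_order all_fingroup all_algebra.
From mathcomp Require Import zify ring.

Set Implicit Arguments.
Unset Strict Implicit.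
Unset Printing Implicit Defensive.

Import Order.TTheory GRing.Theory Num.Theory.
Local Open Scope ring_scope.

(** The idea is to expand over sets of forced ascents.  Write [s_i] for the
    weight of an ascent at the index [i] as [t_i + (s_i - t_i)]: a weighted sum
    over words becomes a sum over the sets [J] of indices where an ascent is
    imposed, the indices outside of [J] being free with weight [t_i].  The words
    that ascend on [J] split at the free indices into independent blocks, and
    since [invD] is the Coxeter length of type D, their generating function is a
    quotient of the generating function of the whole group: each block of [k]
    letters contributes a factor [qfact k] to the denominator, except that the
    first block contributes [Dcount k], [qfact k] or [qfact (k - 1)] if none,
    one or both of the indices [-1] and [1] are free. Only the parity of an
    index matters, so splitting off the last block expresses the two series by
    one another: they solve a linear system of size 2 with coefficients
    [cosh_q] and [sinh_q], and the theorem is Cramer's rule, the determinant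
    being simplified by [cosh_q ^ 2 - sinh_q ^ 2 = e_q (m u) e_q (- m u)].

    The quotients are obtained without parabolic subgroups.  Changing the sign
    of the letter of absolute value 1 changes the parity of the number of
    negative letters but no statistic, so a sum over [Dgroup n] is half of the
    sum over [Bgroup n] ([sum_Dgroup]).  A signed word is built by appending
    letters one at a time; a letter is recorded by its rank among the possible
    ones.  The number of inversions it creates depends on the rank only
    ([invW_ext]) and an ascent is a comparison of two consecutive ranks
    ([ascent_ext_last]).  Hence the sum over all ascending continuations of a
    word does not depend on that word; it is evaluated in [run_sum_total] by a
    recurrence of Pascal type.

    Weighting the beginning of a word and letting the rest ascend gives the
    recursion [head_sumS] with initial value [head_sum2], where the two
    ascent conditions at the indices [-1] and [1] meet.  Solving it
    ([Dratio_sum]) is one identity of power series [series_eq]; its even and odd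
    parts, separated by the substitution of [- u] for [u], are the linear system
    ([even_system], [odd_system]). *)

(** * Signed words *)

Definition signed_word n (s : seq int) : bool :=
  perm_eq [seq `|x|%N | x <- s] (iota 1 n).

(** Makes room for a letter of absolute value [h] without changing any
    comparison between letters and opposites of letters. *)
Definition bumpz (h : nat) (x : int) : int :=
  if x < 0 then - (bump h `|x|)%:Z else (bump h `|x|)%:Z.

Definition unbumpz (h : nat) (x : int) : int :=
  if x < 0 then - (unbump h `|x|)%:Z else (unbump h `|x|)%:Z.

(** The possible last letters of a signed word of length [n.+1], by rank: [p]
    from 0 to [2n+1] enumerates [n+1, ..., 1, -1, ..., -(n+1)]. *)
Definition entry (n p : nat) : int :=
  if (p <= n)%N then (n.+1 - p)%:Z else - (p - n)%:Z.

Definition code (n : nat) (x : int) : nat :=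
  if 0 < x then (n.+1 - `|x|)%N else (n + `|x|)%N.

(** The number of inversions created by the letter of rank [p].  Ranks [n] and
    [n.+1], the letters 1 and -1, have the same cost. *)
Definition cost (n p : nat) : nat := (p - (n < p))%N.

Definition ext (s : seq int) (p : nat) : seq int :=
  let a := entry (size s) p in rcons [seq bumpz `|a| x | x <- s] a.

(** Adding letters by rank makes the statistics of a word read off from its
    last step, at the price of checking that this enumerates all signed words
    ([mem_words], [words_uniq]). *)
Fixpoint words (n : nat) : seq (seq int) :=
  if n is k.+1 then [seq ext s p | s <- words k, p <- iota 0 (k.+1).*2]
  else [:: [::]].

Lemma signed_size n s : signed_word n s -> size s = n.
Proof. by move=> /perm_size; rewrite size_map size_iota. Qed.

Lemma signed_nth_abs n s i :
  signed_word n s -> (i < n)%N -> (0 < `|nth 0%R s i|%N <= n)%N.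
Proof.
move=> sn ltin.
have : `|nth 0%R s i|%N \in [seq `|x|%N | x <- s].
  by rewrite map_f // mem_nth ?(signed_size sn).
by rewrite (perm_mem sn) mem_iota; lia.
Qed.

Lemma signed_nth_inj n s i j :
  signed_word n s -> (i < n)%N -> (j < n)%N ->
  (`|nth 0%R s i|%N == `|nth 0%R s j|%N) = (i == j).
Proof.
move=> sn ltin ltjn; have szs := signed_size sn.
have s_uniq : uniq [seq `|x|%N | x <- s] by rewrite (perm_uniq sn) iota_uniq.
rewrite -(nth_uniq 0%N (i := i) (j := j) _ _ s_uniq) ?size_map ?szs //.
by rewrite !(nth_map 0%R) ?szs.
Qed.

Lemma bumpz_lt h x y : (0 < h)%N -> (bumpz h x < bumpz h y) = (x < y).
Proof.
rewrite /bumpz /bump => h0; case: (ltP x 0) => ?; case: (ltP y 0) => ?; lia.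
Qed.

Lemma bumpzN h x : (0 < h)%N -> bumpz h (- x) = - bumpz h x.
Proof.
by rewrite /bumpz /bump => h0; case: (ltP x 0); case: (ltP (- x) 0) => ? ?; lia.
Qed.

Lemma bumpz_inj h : (0 < h)%N -> injective (bumpz h).
Proof.
move=> h0 x y xy; apply/le_anti.
by rewrite !leNgt -(bumpz_lt x y h0) -(bumpz_lt y x h0) xy ltxx.
Qed.

Lemma abs_bumpz h x : `|bumpz h x|%N = bump h `|x|.
Proof. by rewrite /bumpz; case: ifP => _; rewrite ?abszN. Qed.

Lemma abs_entry_gt0 n p : (0 < `|entry n p|)%N.
Proof. by rewrite /entry; case: (leqP p n); lia. Qed.

Lemma abs_entry_le n p : (p < (n.+1).*2)%N -> (`|entry n p| <= n.+1)%N.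
Proof. by rewrite /entry; case: (leqP p n); lia. Qed.

Lemma codeK n x : x != 0 -> (`|x| <= n.+1)%N -> entry n (code n x) = x.
Proof. by rewrite /entry /code; case: ltP => ? ? ?; case: leqP; lia. Qed.

Lemma entryK n p : (p < (n.+1).*2)%N -> code n (entry n p) = p.
Proof. by rewrite /entry /code; case: (leqP p n) => ? ?; case: ltP; lia. Qed.

Lemma code_lt n x : x != 0 -> (`|x| <= n.+1)%N -> (code n x < (n.+1).*2)%N.
Proof. by rewrite /code; case: (ltP 0 x); lia. Qed.

(** Ascents are read off from ranks.  The ranks of consecutive letters refer to
    alphabets of different sizes, which is why the cost of the last letter and
    not its rank is compared with the rank of the previous one. *)
Lemma entry_ascent n p x : (0 < n)%N -> x != 0 -> (`|x| <= n)%N ->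
  (bumpz `|entry n p| x < entry n p) = (cost n p <= code n.-1 x)%N.
Proof.
rewrite /entry /code /cost /bumpz /bump => n0 x0 xn.
by case: (leqP p n) => pn; case: (ltP x 0) => x1; case: (ltP 0 x) => x2; lia.
Qed.

Lemma perm_bump_iota h n : (0 < h <= n.+1)%N ->
  perm_eq (h :: [seq bump h k | k <- iota 1 n]) (iota 1 n.+1).
Proof.
move=> hn; apply: uniq_perm; last 1 first.
- move=> x; rewrite inE mem_iota; apply/orP/idP.
    case=> [/eqP ->|/mapP[y]]; first lia.
    by rewrite mem_iota /bump => yn ->; lia.
  move=> xn; case: (eqVneq x h) => [_|xh]; first by left.
  right; apply/mapP; exists (unbump h x).
    by rewrite mem_iota /unbump; lia.
  by rewrite /bump /unbump; lia.
- rewrite /= map_inj_uniq ?iota_uniq ?andbT; last exact: can_inj (bumpK h).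
  by apply/mapP => -[y _]; rewrite /bump; lia.
- exact: iota_uniq.
Qed.

Lemma signed_ext n s p : signed_word n s -> (p < (n.+1).*2)%N ->
  signed_word n.+1 (ext s p).
Proof.
move=> sn pn; rewrite /signed_word /ext (signed_size sn) map_rcons.
have hn : (0 < `|entry n p| <= n.+1)%N by rewrite abs_entry_gt0 abs_entry_le.
apply: perm_trans (perm_bump_iota hn).
rewrite perm_rcons perm_cons.
rewrite -map_comp (eq_map (fun x => abs_bumpz _ x)).
by rewrite (map_comp (bump _)) perm_map.
Qed.

Lemma unbumpzK h x : (0 < h)%N -> `|x|%N != h -> bumpz h (unbumpz h x) = x.
Proof.
move=> h0 xh; rewrite /bumpz /unbumpz.
have xK : bump h (unbump h `|x|) = `|x|%N by rewrite unbumpKcond (negbTE xh).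
have : (0 < unbump h `|x|)%N \/ x = 0 by rewrite /unbump; lia.
move: xK; set v := unbump _ _ => xK u0.
by case: (ltP x 0) => x0; case: ltP => v0; rewrite ?abszN ?absz_nat xK; lia.
Qed.

Lemma abs_unbumpz h x : `|unbumpz h x|%N = unbump h `|x|.
Proof. by rewrite /unbumpz; case: ifP => _; rewrite ?abszN. Qed.

Lemma wordsS n :
  words n.+1 = [seq ext s p | s <- words n, p <- iota 0 (n.+1).*2].
Proof. by []. Qed.

Lemma mem_words n s : (s \in words n) = signed_word n s.
Proof.
elim: n s => [|n IHn] s.
  rewrite inE /signed_word; case: s => [|x s] //=.
  by apply/esym/negP => /perm_size.
rewrite wordsS; apply/allpairsP/idP => [[[t p]] [tn]|].
  by rewrite mem_iota => pn ->; apply: signed_ext; [rewrite -IHn | exact: pn].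
case/lastP: s => [/perm_size //|t a] ta.
have [a0 an] : a != 0 /\ (`|a| <= n.+1)%N.
  have : `|a|%N \in [seq `|x|%N | x <- rcons t a].
    by rewrite map_f // mem_rcons mem_head.
  by rewrite (perm_mem ta) mem_iota; lia.
have ha : (0 < `|a| <= n.+1)%N by lia.
have : perm_eq [seq `|x|%N | x <- t] [seq bump `|a| k | k <- iota 1 n].
  rewrite -(perm_cons `|a|%N) (permPr (perm_bump_iota ha)) -(permPr ta).
  by rewrite map_rcons perm_sym perm_rcons.
move=> tE; exists ([seq unbumpz `|a| x | x <- t], code n a).
have tn : signed_word n [seq unbumpz `|a| x | x <- t].
  rewrite /signed_word -map_comp (eq_map (fun x => abs_unbumpz _ x)).
  rewrite (map_comp (unbump _)) (permPl (perm_map _ tE)).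
  by rewrite -map_comp (eq_map (bumpK _)) map_id.
split; [by rewrite IHn | by rewrite mem_iota code_lt |].
rewrite [_.1]/= [_.2]/=.
rewrite /ext (signed_size tn) codeK // -map_comp; congr rcons.
rewrite -[LHS]map_id; apply/eq_in_map => x xt /=.
rewrite unbumpzK //; first lia.
have : `|x|%N \in [seq bump `|a| k | k <- iota 1 n].
  by rewrite -(perm_mem tE) map_f.
by case/mapP => k _ ->; rewrite eq_sym neq_bump.
Qed.

Lemma words_uniq n : uniq (words n).
Proof.
elim: n => // n IHn; rewrite wordsS.
apply: allpairs_uniq => //; first exact: iota_uniq.
move=> [s p] [t r] /allpairsP[[s' p'] [+ + [-> ->]]].
rewrite mem_words mem_iota => sn pn /allpairsP[[t' r'] [+ + [-> ->]]].
rewrite mem_words mem_iota => tn rn; move: sn pn tn rn => /= sn pn tn rn.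
rewrite /ext (signed_size sn) (signed_size tn) => /rcons_inj[+ pr].
have {pr}-> : p' = r' by rewrite -(entryK pn) pr entryK.
by move=> /(inj_map (bumpz_inj (abs_entry_gt0 _ _))) ->.
Qed.

(** * Windows of signed permutations *)

Lemma sval_int_inj n : injective (@sval_int n).
Proof.
move=> [i b] [j c]; rewrite /sval_int /= => e.
have ij : i = j :> nat by case: b c e => [] [] /=; lia.
have <- : i = j by apply: val_inj.
by congr pair; case: b c e => [] [] //=; lia.
Qed.

Lemma abs_sval_int n (x : signed n) : `|sval_int x|%N = x.1.+1.
Proof. by rewrite /sval_int; case: x.2 => /=; lia. Qed.

Lemma size_window n (w : {perm signed n}) : size (window w) = n.
Proof. by rewrite size_map size_enum_ord. Qed.

Lemma nth_window n (w : {perm signed n}) (i : 'I_n) :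
  (window w)`_i = sval_int (w (i, false)).
Proof. by rewrite (nth_map i) ?size_enum_ord // nth_ord_enum. Qed.

Lemma BgroupP n (w : {perm signed n}) :
  reflect (forall x, w (sopp x) = sopp (w x)) (w \in Bgroup n).
Proof. by rewrite inE; apply: (iffP forallP) => H x; apply/eqP. Qed.

Lemma soppE n (i : 'I_n) : (i, true) = sopp (i, false).
Proof. by []. Qed.

Lemma window_inj n : {in Bgroup n &, injective (@window n)}.
Proof.
move=> v w /BgroupP vB /BgroupP wB vw.
have vwf i : v (i, false) = w (i, false).
  by apply: sval_int_inj; rewrite -!nth_window vw.
by apply/permP => -[i []] //; rewrite soppE vB wB vwf.
Qed.

Lemma window_signed n (w : {perm signed n}) :
  w \in Bgroup n -> signed_word n (window w).
Proof.
move=> /BgroupP wB; rewrite /signed_word -map_comp.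
have inj_abs : injective (fun i : 'I_n => (w (i, false)).1).
  move=> i j ij.
  have : w (i, false) = w (j, false) \/ w (i, false) = w (sopp (j, false)).
    rewrite wB /sopp; case: (w _) ij => [a b]; case: (w _) => [c d] /= ->.
    by case: b d => [] []; [left|right|right|left].
  by case=> /perm_inj [].
set l := [seq _ | i <- _].
have l_uniq : uniq l.
  rewrite map_inj_uniq ?enum_uniq // => i j /=.
  by rewrite !abs_sval_int => -[] /val_inj; apply: inj_abs.
have l_sub : {subset l <= iota 1 n}.
  move=> k /mapP[i _ ->] /=; rewrite abs_sval_int mem_iota.
  by rewrite add1n !ltnS leq0n ltn_ord.
apply: uniq_perm; rewrite ?iota_uniq //.
case: (uniq_min_size l_uniq l_sub) => //.
by rewrite size_map size_enum_ord size_iota.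
Qed.

Lemma signed_window n s : signed_word n s ->
  exists2 w : {perm signed n}, w \in Bgroup n & window w = s.
Proof.
move=> sn; have szs := signed_size sn.
have abs_s (i : 'I_n) := signed_nth_abs sn (ltn_ord i).
have abs_lt (i : 'I_n) : ((absz (s`_i)%R).-1 < n)%N by have := abs_s i; lia.
pose f (x : signed n) : signed n :=
  (Ordinal (abs_lt x.1), (s`_(x.1) < 0) (+) x.2).
have f_inj : injective f.
  move=> [i b] [j c] [] /= ij.
  have abs_ij : `|(s`_i)%R|%N = `|(s`_j)%R|%N.
    by move: (abs_s i) (abs_s j) => /=; lia.
  have -> : i = j.
    by apply: ord_inj; apply/eqP; rewrite -(signed_nth_inj sn) // abs_ij.
  by move=> /addbI ->.
exists (perm f_inj).
  apply/BgroupP => -[i b]; rewrite !permE /f /sopp /=.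
  by rewrite addbN.
apply: (@eq_from_nth _ 0); rewrite size_window ?szs // => i ltin.
rewrite (nth_window _ (Ordinal ltin)) permE /f /sval_int /= addbF.
have := abs_s (Ordinal ltin); rewrite /=.
by case: ltP => /=; lia.
Qed.

Lemma perm_windows n :
  perm_eq [seq window w | w <- enum (Bgroup n)] (words n).
Proof.
apply: uniq_perm; rewrite ?words_uniq //.
  rewrite map_inj_in_uniq ?enum_uniq // => v w.
  by rewrite !mem_enum; apply: window_inj.
move=> s; rewrite mem_words; apply/mapP/idP => [[w]|/signed_window[w wB <-]].
  by rewrite mem_enum => wB ->; apply: window_signed.
by exists w; rewrite ?mem_enum.
Qed.

(** Sums over signed permutations become sums over an explicit list of words.
    The side condition serves the parity condition of [Dgroup]. *)
Lemma sum_Bgroup (R : nmodType) n (Q : pred (seq int)) (F : seq int -> R) :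
  \sum_(w in Bgroup n | Q (window w)) F (window w)
  = \sum_(s <- words n | Q s) F s.
Proof.
by rewrite -(perm_big _ (perm_windows n)) big_map -big_enum_cond.
Qed.

(** * Statistics of words *)

Definition invW (s : seq int) : nat :=
  \sum_(j < size s) \sum_(i < j)
    (((s`_j < s`_i)%R : nat) + ((s`_j < - s`_i)%R : nat))%N.

Lemma card_pairs n (r : nat -> nat -> bool) :
  #|[set ij : 'I_n * 'I_n | (ij.1 < ij.2)%N & r ij.1 ij.2]|
  = (\sum_(j < n) \sum_(i < j) r i j)%N.
Proof.
rewrite -sum1dep_card big_mkcond /=.
rewrite -(pair_bigA _ (fun i j : 'I_n =>
  if (i < j)%N && r i j then 1 else 0)%N) /= exchange_big.
apply: eq_bigr => j _ /=.
rewrite (big_ord_widen n (fun i => r i j : nat) (ltnW (ltn_ord j))).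
rewrite [RHS]big_mkcond.
by apply: eq_bigr => i _; case: ltnP => //= _; case: (r i j).
Qed.

Lemma invD_window n (w : {perm signed n}) : invD w = invW (window w).
Proof.
rewrite /invD /invW size_window.
rewrite (card_pairs n (fun i j => (window w)`_j < (window w)`_i)).
rewrite (card_pairs n (fun i j => (window w)`_j < - (window w)`_i)).
by rewrite -big_split; apply: eq_bigr => j _; rewrite -big_split.
Qed.

Lemma size_ext s p : size (ext s p) = (size s).+1.
Proof. by rewrite size_rcons size_map. Qed.

Lemma nth_ext s p i : (i < size s)%N ->
  (ext s p)`_i = bumpz `|entry (size s) p| s`_i.
Proof. by move=> lti; rewrite nth_rcons size_map lti (nth_map 0). Qed.

Lemma nth_ext_last s p : (ext s p)`_(size s) = entry (size s) p.
Proof. by rewrite nth_rcons size_map ltnn eqxx. Qed.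

Lemma sum_geq h n : (0 < h)%N -> (\sum_(1 <= r < n.+1) (h <= r) = n.+1 - h)%N.
Proof.
move=> h0; elim: n => [|n IHn]; first by rewrite big_geq //; lia.
by rewrite big_nat_recr //= IHn; lia.
Qed.

Lemma sum_lt h n : (0 < h)%N -> (\sum_(1 <= r < n.+1) (r < h) = minn n h.-1)%N.
Proof.
move=> h0; elim: n => [|n IHn]; first by rewrite big_geq //; lia.
by rewrite big_nat_recr //= IHn; lia.
Qed.

(** Both inversion conditions together treat a letter and its opposite alike, so
    the contribution of a letter of [s] depends on its absolute value [r] only,
    and [r] runs through 1, ..., n. *)
Lemma invW_ext n s p : signed_word n s -> (p < (n.+1).*2)%N ->
  invW (ext s p) = (invW s + cost n p)%N.
Proof.
move=> sn pn; have szs := signed_size sn.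
have h0 := abs_entry_gt0 (size s) p.
rewrite /invW size_ext big_ord_recr /=; congr addn.
  apply: eq_bigr => j _; apply: eq_bigr => i _.
  rewrite !nth_ext ?(ltn_trans (ltn_ord i)) //.
  by rewrite -bumpzN // !bumpz_lt.
rewrite nth_ext_last szs.
pose g r : nat :=
  if (p <= n)%N then (n.+1 - p <= r)%N : nat else (1 + (r < p - n))%N.
transitivity (\sum_(x <- s) g `|x|%N)%N.
  rewrite (big_nth 0) big_mkord szs; apply: eq_bigr => i _.
  rewrite nth_ext ?szs //; have := signed_nth_abs sn (ltn_ord i).
  move: (nth _ _ _) => /= x x0.
  rewrite /g /entry; case: (leqP p n) => lepn; rewrite ?abszN ?absz_nat;
    rewrite /bumpz /bump; case: (ltP x 0) => ltx; lia.
rewrite -(big_map (fun x : int => `|x|%N) xpredT g) (perm_big _ sn) /=.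
have -> : iota 1 n = index_iota 1 n.+1 by rewrite /index_iota subn1.
rewrite /g /cost; case: (leqP p n) => lepn.
  by rewrite sum_geq; lia.
by rewrite big_split /= sum_lt ?sum_nat_const_nat; lia.
Qed.

Lemma Dindices_ge2 n :
  Dindices n.+2 = (-1 : int) :: [seq i%:Z | i <- iota 1 n.+1].
Proof.
rewrite /Dindices /=; congr cons; congr cons.
apply/all_filterP/allP => i /mapP[k]; rewrite mem_iota => kn -> /=; lia.
Qed.

Lemma DindicesS n : Dindices n.+3 = rcons (Dindices n.+2) n.+2%:Z.
Proof.
rewrite !Dindices_ge2; have -> : iota 1 n.+2 = rcons (iota 1 n.+1) n.+2.
  by rewrite -cats1 -{1}(addn1 n.+1) iotaD.
by rewrite map_rcons.
Qed.

Lemma mem_Dindices n i : i \in Dindices n ->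
  (i = -1 \/ exists k : nat, i = k.+1) /\ (`|i| < n)%N.
Proof.
rewrite mem_filter inE => /andP[lt_in iE]; split=> //.
case/orP: iE => [/eqP ->|/mapP[[|k]]]; first by left.
  by rewrite mem_iota.
by move=> _ ->; right; exists k.
Qed.

(** For the window of [w], this is [wentry w]. *)
Definition entry_at (s : seq int) (i : int) : int :=
  match i with Posz k => s`_k.-1 | Negz k => - s`_k end.

Definition ascent_at (s : seq int) (i : int) : bool :=
  entry_at s i < entry_at s (`|i|.+1)%N.

Lemma entry_at_neq n s i : signed_word n s -> i \in Dindices n ->
  entry_at s i != entry_at s (`|i|.+1)%N.
Proof.
move=> sn /mem_Dindices[[->|[k ->]]] /= kn; apply/eqP => e.
  by have := signed_nth_inj sn (ltnW kn) kn; rewrite -e abszN eqxx.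
by have := signed_nth_inj sn (ltnW kn) kn; rewrite -e eqxx ltn_eqF.
Qed.

Lemma ascent_ext n s p i : signed_word n s -> i \in Dindices n ->
  ascent_at (ext s p) i = ascent_at s i.
Proof.
move=> sn iD; have szs := signed_size sn; have h0 := abs_entry_gt0 n p.
have [+ ltin] := mem_Dindices iD; rewrite /ascent_at.
case=> [iE|[k iE]]; move: ltin; rewrite iE /= => ltin.
  by rewrite !nth_ext szs ?(ltnW ltin) // -bumpzN // bumpz_lt.
by rewrite !nth_ext szs ?(ltnW ltin) // bumpz_lt.
Qed.

Lemma ascent_ext_last n s p : signed_word n.+1 s ->
  ascent_at (ext s p) n.+1%:Z = (cost n.+1 p <= code n s`_n)%N.
Proof.
move=> sn; have szs := signed_size sn; rewrite /ascent_at /=.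
have -> : (ext s p)`_n.+1 = entry n.+1 p by rewrite -szs nth_ext_last.
rewrite nth_ext szs //.
have := signed_nth_abs sn (ltnSn n) => sn0.
by rewrite entry_ascent //; lia.
Qed.

(** An ascent at -1 is an ascent at 1 of the word whose first letter changes
    sign. *)
Lemma ascent_ext_first s p : signed_word 1 s ->
  ascent_at (ext s p) (-1) = (cost 1 p <= code 0 (- s`_0))%N.
Proof.
move=> sn; have szs := signed_size sn; rewrite /ascent_at /=.
have -> : (ext s p)`_1 = entry 1 p by rewrite -szs nth_ext_last.
rewrite nth_ext szs // -bumpzN ?abs_entry_gt0 //.
have := signed_nth_abs sn (ltnSn 0) => sn0.
by rewrite entry_ascent //; lia.
Qed.

Section Weight.
Variables (K : fieldType) (s0 s1 t0 t1 : K).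

Definition step_weight (i : nat) (asc : bool) : K :=
  if asc then if odd i then s1 else s0 else if odd i then t1 else t0.

Definition weight (s : seq int) : K :=
  \prod_(i <- Dindices (size s)) step_weight `|i| (ascent_at s i).

(** The assumption excludes ties, which the counts ignore but which have weight
    [t0] or [t1] in the product. *)
Lemma monomial_prod (l : seq int) (x y : int -> int) :
  {in l, forall i, x i != y i} ->
  s0 ^+ count (fun i : int => ~~ odd `|i|%N && (x i < y i)) l *
  s1 ^+ count (fun i : int => odd `|i|%N && (x i < y i)) l *
  t0 ^+ count (fun i : int => ~~ odd `|i|%N && (y i < x i)) l *
  t1 ^+ count (fun i : int => odd `|i|%N && (y i < x i)) l
  = \prod_(i <- l) step_weight `|i| (x i < y i).
Proof.
elim: l => [|i l IHl] xy /=; first by rewrite big_nil !expr0 !mulr1.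
rewrite big_cons -IHl => [|j jl]; last by rewrite xy // inE jl orbT.
have := xy i (mem_head _ _); rewrite /step_weight !exprD.
by case: ltgtP => // _ _; case: odd; rewrite /= !expr1 !expr0; ring.
Qed.

Lemma weight_window n (w : {perm signed n}) : w \in Bgroup n ->
  s0 ^+ eascD w * s1 ^+ oascD w * t0 ^+ edesD w * t1 ^+ odesD w
  = weight (window w).
Proof.
move=> wB; rewrite /weight size_window.
apply: (monomial_prod (x := entry_at (window w))
                      (y := fun i => entry_at (window w) (`|i|.+1)%N)).
by move=> i; apply: entry_at_neq (window_signed wB).
Qed.

Lemma weight_ext n s p : signed_word n.+2 s ->
  weight (ext s p)
  = weight s * step_weight n.+2 (cost n.+2 p <= code n.+1 s`_n.+1)%N.
Proof.
move=> sn; rewrite /weight size_ext (signed_size sn) DindicesS big_rcons /=.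
rewrite (ascent_ext_last _ sn); congr (_ * _).
rewrite !big_seq; apply: eq_bigr => i iD.
by rewrite (ascent_ext _ sn).
Qed.

Lemma weight_ext1 s p : signed_word 1 s ->
  weight (ext s p) = step_weight 1 (cost 1 p <= code 0 (- s`_0))%N
                     * step_weight 1 (cost 1 p <= code 0 s`_0)%N.
Proof.
move=> sn; rewrite /weight size_ext (signed_size sn) Dindices_ge2.
rewrite !big_cons big_nil mulr1.
by rewrite (ascent_ext_last _ sn) (ascent_ext_first _ sn).
Qed.

End Weight.

(** * From even-signed permutations to all signed permutations *)

(** The involution that exchanges even and odd words: the letter of absolute
    value 1 is the smallest one in absolute value, so its sign influences none of
    the comparisons that define the statistics. *)
Definition flip1 (x : int) : int := if `|x|%N == 1%N then - x else x.

Lemma abs_flip1 x : `|flip1 x|%N = `|x|%N.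
Proof. by rewrite /flip1; case: ifP => _; rewrite ?abszN. Qed.

Lemma flip1K : involutive flip1.
Proof.
move=> x; rewrite {1}/flip1 abs_flip1 /flip1.
by case: (_ == _); rewrite ?opprK.
Qed.

Lemma flip1N x : flip1 (- x) = - flip1 x.
Proof. by rewrite /flip1 abszN; case: ifP. Qed.

Lemma flip1_lt (x y : int) : x != 0 -> y != 0 -> `|x|%N != `|y|%N ->
  (flip1 x < flip1 y) = (x < y).
Proof.
by move=> x0 y0 xy; rewrite /flip1; case: eqP => ?; case: eqP => ?; lia.
Qed.

Lemma signed_flip1 n s : signed_word n (map flip1 s) = signed_word n s.
Proof. by rewrite /signed_word -map_comp (eq_map abs_flip1). Qed.

Lemma nth_flip1 s i : (map flip1 s)`_i = flip1 s`_i.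
Proof.
case: (ltnP i (size s)) => ltis; first by rewrite (nth_map 0).
by rewrite !nth_default ?size_map.
Qed.

Lemma flip1_nth_lt n s i j : signed_word n s -> (i < n)%N -> (j < n)%N ->
  i != j -> (flip1 s`_i < flip1 s`_j) = (s`_i < s`_j)
         /\ (flip1 s`_i < - flip1 s`_j) = (s`_i < - s`_j)
         /\ (- flip1 s`_i < flip1 s`_j) = (- s`_i < s`_j).
Proof.
move=> sn ltin ltjn; rewrite -(signed_nth_inj sn ltin ltjn).
have := signed_nth_abs sn ltin; have := signed_nth_abs sn ltjn.
move: (nth _ _ _) (nth _ _ _) => /= y x y0 x0 xy.
by rewrite -!flip1N !flip1_lt ?abszN //; lia.
Qed.

Lemma invW_flip1 n s : signed_word n s -> invW (map flip1 s) = invW s.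
Proof.
move=> sn; rewrite /invW size_map (signed_size sn).
apply: eq_bigr => j _; apply: eq_bigr => i _; rewrite !nth_flip1.
have ltin := ltn_trans (ltn_ord i) (ltn_ord j).
by have [| -> [-> _]] := flip1_nth_lt sn (ltn_ord j) ltin; rewrite // gtn_eqF.
Qed.

Lemma weight_flip1 (K : fieldType) (s0 s1 t0 t1 : K) n s : signed_word n s ->
  weight s0 s1 t0 t1 (map flip1 s) = weight s0 s1 t0 t1 s.
Proof.
move=> sn; rewrite /weight size_map (signed_size sn) !big_seq.
apply: eq_bigr => i iD; congr step_weight; rewrite /ascent_at.
have [+ ltin] := mem_Dindices iD.
case=> [iE|[k iE]]; move: ltin; rewrite iE /= => ltin; rewrite !nth_flip1.
  by have [| _ [_ ->]] := flip1_nth_lt sn (ltnW ltin) ltin.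
by have [| -> _] := flip1_nth_lt sn (ltnW ltin) ltin; rewrite // ltn_eqF.
Qed.

Definition even_word (s : seq int) : bool :=
  ~~ odd (count (fun x : int => x < 0) s).

Lemma even_flip1 n s : (0 < n)%N -> signed_word n s ->
  even_word (map flip1 s) = ~~ even_word s.
Proof.
move=> n0 sn; rewrite /even_word negbK count_map.
have s_neq0 : all (fun x : int => x != 0) s.
  apply/allP => x xs; have : `|x|%N \in [seq `|x|%N | x <- s] by rewrite map_f.
  by rewrite (perm_mem sn) mem_iota; lia.
have parity : odd (count (preim flip1 (fun x : int => x < 0)) s)
    = odd (count (fun x : int => x < 0) s)
      (+) odd (count (pred1 1%N) [seq `|x|%N | x <- s]).
  elim: s s_neq0 {sn} => //= x s IHs /andP[x0 /IHs{}IHs].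
  rewrite !oddD !oddb IHs /flip1.
  case: (eqVneq `|x|%N 1%N) => [x1|_] /=; last by rewrite -addbA.
  have -> : (- x < 0) = ~~ (x < 0) by lia.
  by case: (x < 0); case: odd; case: odd.
rewrite parity (seq.permP sn) count_uniq_mem ?iota_uniq // mem_iota.
have -> : (0 < 1 < 1 + n)%N by lia.
by rewrite oddb addbT negbK.
Qed.

Lemma perm_flip1 n : perm_eq (map (map flip1) (words n)) (words n).
Proof.
have flipsK : involutive (map flip1) by apply: mapK flip1K.
apply: uniq_perm; rewrite ?words_uniq // ?map_inj_uniq ?words_uniq //.
  exact: can_inj flipsK.
move=> s; rewrite mem_words; apply/mapP/idP => [[t]|sn].
  by rewrite mem_words => tn ->; rewrite signed_flip1.
by exists (map flip1 s); rewrite ?flipsK // mem_words signed_flip1.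
Qed.

Lemma sum_even_words (K : fieldType) n (F : seq int -> K) :
  (0 < n)%N -> (forall s, signed_word n s -> F (map flip1 s) = F s) ->
  \sum_(s <- words n) F s = 2 * \sum_(s <- words n | even_word s) F s.
Proof.
move=> n_gt0 F_flip1; rewrite (bigID even_word) /= mulr_natl mulr2n.
congr (_ + _); rewrite -(perm_big _ (perm_flip1 n)) big_map.
rewrite [LHS]big_seq_cond [RHS]big_seq_cond.
apply: eq_big => [s|s /andP[+ _]]; last by rewrite mem_words; apply: F_flip1.
rewrite mem_words; case sn: (signed_word n s) => //=.
by rewrite (even_flip1 n_gt0 sn) negbK.
Qed.

Lemma sum_Dgroup (K : fieldType) n (F : seq int -> K) :
  (0 < n)%N -> (forall s, signed_word n s -> F (map flip1 s) = F s) ->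
  \sum_(s <- words n) F s = 2 * \sum_(w in Dgroup n) F (window w).
Proof.
move=> n_gt0 F_flip1; rewrite sum_even_words // -sum_Bgroup; congr (_ * _).
by apply: eq_bigl => w; rewrite !inE.
Qed.

(** * Counting ascending extensions *)

Section Chains.
Variables (K : fieldType) (q : K).

(** The sum of [q ^+ cost] over the ways of appending [l] letters to a word of
    length [j] whose last letter has rank [z], with an ascent at each step.  A
    rank [z >= 2j] imposes nothing on the first of these letters. *)
Fixpoint chain_sum (l j z : nat) : K :=
  if l is l'.+1 then
    \sum_(0 <= p < (j.+1).*2 | (cost j p <= z)%N)
      q ^+ cost j p * chain_sum l' j.+1 p
  else 1.

Lemma chain_sumS l j z : chain_sum l.+1 j z =
  \sum_(0 <= p < (j.+1).*2 | (cost j p <= z)%N)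
    q ^+ cost j p * chain_sum l j.+1 p.
Proof. by []. Qed.

Definition run_sum (l j : nat) : K := chain_sum l j (j.*2).

Lemma run_sumS l j : run_sum l.+1 j =
  \sum_(0 <= p < (j.+1).*2) q ^+ cost j p * chain_sum l j.+1 p.
Proof.
rewrite /run_sum /= big_nat_cond [RHS]big_nat_cond; apply: eq_bigl => p.
by rewrite /cost; lia.
Qed.

Lemma costS j p : cost j.+1 p.+1 = (cost j p).+1.
Proof. by rewrite /cost; lia. Qed.

Lemma cost0 j : cost j 0 = 0%N.
Proof. by []. Qed.

Lemma chain_sum0 l j : chain_sum l j.+1 0 = 1.
Proof.
elim: l j => //= l IHl j.
rewrite doubleS big_mkcond big_nat_recl // cost0 /= IHl expr0 mulr1.
rewrite big_nat_cond big1 ?addr0 // => p _; case: ifP => //; rewrite /cost; lia.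
Qed.

(** A letter of rank 0 is the largest possible one; the others, except the
    smallest possible one, correspond to letters over a smaller alphabet. *)
Lemma sum_cost_shift j z (F : nat -> K) : (z <= j.*2)%N ->
  \sum_(0 <= p < (j.+2).*2 | (cost j.+1 p <= z.+1)%N) F p
  = F 0%N + \sum_(0 <= p < (j.+1).*2 | (cost j p <= z)%N) F p.+1.
Proof.
move=> zj; rewrite doubleS big_mkcond big_nat_recl // cost0 /=; congr (_ + _).
rewrite big_nat_recr //= [X in _ + X]ifF ?addr0; last by rewrite /cost; lia.
by rewrite [RHS]big_mkcond; apply: eq_bigr => p _; rewrite costS ltnS.
Qed.

Lemma sum_full_shift j (F : nat -> K) :
  \sum_(0 <= p < (j.+2).*2) F p
  = F 0%N + \sum_(0 <= p < (j.+1).*2) F p.+1 + F (j.*2.+3).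
Proof. by rewrite doubleS big_nat_recl // big_nat_recr // addrA doubleS. Qed.

(** Splitting according to whether the last letter has rank 0.  If it has,
    it can be removed; if not, no letter has rank 0 and, as [z <= 2j], none has
    the largest rank either, so that all ranks can be lowered by 1. *)
Lemma chain_sum_shift l j z : (z <= j.*2)%N ->
  chain_sum l.+1 j.+1 z.+1
  = chain_sum l j.+1 z.+1 + q ^+ l.+1 * chain_sum l.+1 j z.
Proof.
elim: l j z => [|l IHl] j z zj; rewrite [LHS]chain_sumS sum_cost_shift // cost0.
  rewrite mulr1 [chain_sum _ _ _]/= expr0; congr (_ + _); rewrite mulr_sumr.
  by apply: eq_bigr => p _; rewrite costS !mulr1 exprS expr1.
rewrite chain_sum0 [chain_sum l.+1 j.+1 _]chain_sumS.
rewrite sum_cost_shift // cost0 chain_sum0.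
rewrite -addrA; congr (_ + _); rewrite [chain_sum l.+2 _ _]chain_sumS mulr_sumr.
rewrite -big_split [LHS]big_nat_cond [RHS]big_nat_cond; apply: eq_bigr => p pj.
rewrite IHl; last by lia.
by rewrite costS exprS [q ^+ l.+2]exprS /=; ring.
Qed.

(** The analogue of Pascal's rule.  The first letter may now have the largest
    rank; this case, without
    a letter of rank 0, accounts for the term with [q ^+ (j.+1.*2 + l)]. *)
Lemma run_sum_rec l j : run_sum l.+1 j.+1 =
  (1 + q ^+ (j.+1.*2 + l)) * run_sum l j.+1 + q ^+ l.+1 * run_sum l.+1 j.
Proof.
rewrite [LHS]run_sumS sum_full_shift cost0 [run_sum l.+1 j]run_sumS.
have -> : cost j.+1 (j.*2.+3) = j.+1.*2 by rewrite /cost; lia.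
case: l => [|l].
  rewrite /run_sum /= addn0 expr0 expr1 !mulr1 addrAC; congr (_ + _).
  by rewrite mulr_sumr; apply: eq_bigr => p _; rewrite costS !mulr1 exprS.
have shift p : (p <= j.+1.*2)%N ->
   q ^+ cost j.+1 p.+1 * chain_sum l.+1 j.+2 p.+1
   = q ^+ cost j.+1 p.+1 * chain_sum l j.+2 p.+1
     + q ^+ l.+2 * (q ^+ cost j p * chain_sum l.+1 j.+1 p).
  by move=> pj; rewrite chain_sum_shift // costS !exprS /=; ring.
rewrite big_nat_cond (eq_bigr _ (fun p pj => shift p _)) => [|p]; last by lia.
rewrite -big_nat_cond big_split -mulr_sumr chain_sum_shift ?doubleS //.
have := run_sumS l j.+1; rewrite sum_full_shift chain_sum0 cost0.
have -> : cost j.+1 (j.*2.+3) = j.+1.*2 by rewrite /cost; lia.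
rewrite chain_sum0 -/(run_sum l.+1 j.+1) => -> /=.
rewrite !doubleS exprD [q ^+ l.+2]exprS.
set A := \sum_(_ <= _ < _) _; set B := \sum_(_ <= _ < _) _.
by ring.
Qed.

Lemma run_sum_rec0 l : run_sum l.+1 0 = (1 + q ^+ l) * run_sum l 0.
Proof.
have split2 l' : run_sum l'.+1 0 = 1 + chain_sum l' 1 1.
  rewrite run_sumS big_nat_recl // big_nat1 chain_sum0 /cost /=.
  by rewrite expr0 !mul1r.
case: l => [|l]; first by rewrite split2 /run_sum /= expr0 mulr1.
rewrite split2 chain_sum_shift // addrA -split2 mulrDl mul1r; congr (_ + _ * _).
Qed.

(** The sum of [q ^+ invW s] over the signed words of length [n]; see
    [sum_words_inv]. *)
Definition Bcount (n : nat) : K := \prod_(i < n) (qint i.+1 q * (1 + q ^+ i)).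

Lemma qintD a b : qint (a + b) q = qint a q + q ^+ a * qint b q.
Proof.
rewrite /qint big_split_ord mulr_sumr; congr (_ + _).
by apply: eq_bigr => i _; rewrite exprD.
Qed.

Lemma expr_qint a : q ^+ a = 1 - (1 - q) * qint a q.
Proof. by rewrite -[LHS](subrK 1) subrX1 /qint; ring. Qed.

Lemma qfactS l : qfact l.+1 q = qfact l q * qint l.+1 q.
Proof. by rewrite /qfact big_nat_recr. Qed.

(** The counterpart of the quotient of the length generating function of a
    Coxeter group by that of a parabolic subgroup: shuffling the [l] appended
    letters in all possible ways, counted by [qfact l q], fills the gap between
    words of length [j] and words of length [j + l]. *)
Lemma run_sum_total l j :
  Bcount j * run_sum l j * qfact l q = Bcount (j + l).
Proof.
elim: l j => [|l IHl] j.
  by rewrite addn0 /run_sum /qfact big_geq //= !mulr1.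
elim: j => [|j IHj].
  rewrite run_sum_rec0 qfactS add0n {2}/Bcount big_ord_recr -/(Bcount l) /=.
  by rewrite -[Bcount l in RHS]/(Bcount (0 + l)) -IHl; ring.
rewrite run_sum_rec mulrDr mulrDl.
have BS n : Bcount n.+1 = Bcount n * (qint n.+1 q * (1 + q ^+ n)).
  by rewrite /Bcount big_ord_recr.
have -> : Bcount j.+1 * (q ^+ l.+1 * run_sum l.+1 j) * qfact l.+1 q
   = Bcount (j.+1 + l) * (q ^+ l.+1 * (qint j.+1 q * (1 + q ^+ j))).
  by rewrite addSnnS -IHj BS; ring.
rewrite qfactS.
have -> : Bcount j.+1 * ((1 + q ^+ (j.+1.*2 + l)) * run_sum l j.+1) *
   (qfact l q * qint l.+1 q)
   = Bcount (j.+1 + l) * ((1 + q ^+ (j.+1.*2 + l)) * qint l.+1 q).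
  by rewrite -IHl; ring.
rewrite -mulrDr addnS BS; congr (_ * _).
have -> : (j.+1 + l).+1 = (l.+1 + j.+1)%N by lia.
rewrite qintD -addnn.
have -> : q ^+ (j.+1 + j.+1 + l) = q ^+ l.+1 * q ^+ j * q ^+ j.+1.
  by rewrite -!exprD; congr (_ ^+ _); lia.
have -> : q ^+ (j.+1 + l) = q ^+ l.+1 * q ^+ j.
  by rewrite -exprD; congr (_ ^+ _); lia.
have := expr_qint j.+1; have := expr_qint l.+1.
move=> -> ->; ring.
Qed.

End Chains.

(** * Power series *)

Section Series.
Variables (K : fieldType) (q : K).

Lemma fcoefD (f g : fps K) n : fcoef (f + g) n = fcoef f n + fcoef g n.
Proof. by []. Qed.

Lemma fcoefN (f : fps K) n : fcoef (- f) n = - fcoef f n.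
Proof. by []. Qed.

Lemma fcoefZ a (f : fps K) n : fcoef (a *: f) n = a * fcoef f n.
Proof. by []. Qed.

Lemma fcoef1 n : fcoef (1 : fps K) n = (n == 0)%:R.
Proof. by []. Qed.

Lemma fcoefM (f g : fps K) n :
  fcoef (f * g) n = \sum_(i < n.+1) fcoef f i * fcoef g (n - i).
Proof. by []. Qed.

Lemma fcoefX n : fcoef (fpsX : fps K) n = (n == 1)%:R.
Proof. by []. Qed.

Lemma fcoefXM (f : fps K) n : fcoef (fpsX * f) n.+1 = fcoef f n.
Proof.
rewrite fcoefM 2!big_ord_recl big1 => [|i _]; last by rewrite fcoefX mul0r.
by rewrite !fcoefX /= mul0r mul1r add0r addr0 subn1.
Qed.

Lemma fcoefXM0 (f : fps K) : fcoef (fpsX * f) 0 = 0.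
Proof. by rewrite fcoefM big_ord1 fcoefX mul0r. Qed.

Lemma fcoefE c n : fcoef (e_q q c) n = c ^+ n / qfact n q.
Proof. by []. Qed.

Lemma fcoefED c n : fcoef (exp_D q c) n = c ^+ n / Dcount n q.
Proof. by []. Qed.

Definition fcoef_simp :=
  (fcoefD, fcoefN, fcoefZ, fcoef1, fcoefX, fcoefXM0, fcoefXM, fcoefE, fcoefED).

Lemma fcoefM_shift2 (f g : fps K) n :
  fcoef f 0 = 0 -> fcoef f 1 = 0 -> fcoef g 0 = 0 ->
  fcoef (f * g) n.+2 = \sum_(k < n) fcoef f k.+2 * fcoef g (n - k).
Proof.
move=> f0 f1 g0; rewrite fcoefM 2!big_ord_recl big_ord_recr /=.
by rewrite f0 f1 /bump /= !add1n subnn g0 !mul0r mulr0 !add0r addr0.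
Qed.

(** The substitution of [- u] for [u]. *)
Definition fps_flip (f : fps K) : fps K := Fps (fun n => (-1) ^+ n * fcoef f n).

Lemma fps_flipD f g : fps_flip (f + g) = fps_flip f + fps_flip g.
Proof. by apply/fpsP => n; rewrite /= mulrDr. Qed.

Lemma fps_flipN f : fps_flip (- f) = - fps_flip f.
Proof. by apply/fpsP => n; rewrite /= mulrN. Qed.

Lemma fps_flipZ a f : fps_flip (a *: f) = a *: fps_flip f.
Proof. by apply/fpsP => n; rewrite /= mulrCA. Qed.

Lemma fps_flipM f g : fps_flip (f * g) = fps_flip f * fps_flip g.
Proof.
apply/fpsP => n; rewrite /= mulr_sumr; apply: eq_bigr => i _.
by rewrite mulrACA -exprD subnKC // -ltnS.
Qed.

Lemma fps_flip1 : fps_flip 1 = 1.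
Proof. by apply/fpsP => -[|n] /=; rewrite ?mulr0 // expr0 mulr1. Qed.

Lemma fps_flipX : fps_flip fpsX = - fpsX.
Proof.
by apply/fpsP => -[|[|n]] /=; rewrite ?mulr0 ?oppr0 // expr1 mulr1.
Qed.

Lemma fps_flip_eq c : fps_flip (e_q q c) = e_q q (- c).
Proof. by apply/fpsP => n /=; rewrite mulrA -exprNn. Qed.

Lemma fps_flip_expD c : fps_flip (exp_D q c) = exp_D q (- c).
Proof. by apply/fpsP => n /=; rewrite mulrA -exprNn. Qed.

(** Turns scaling into multiplication, for the benefit of [ring]. *)
Definition fpsC (x : K) : fps K := x%:A.

Lemma scaleC x (f : fps K) : x *: f = fpsC x * f.
Proof. by rewrite mulr_algl. Qed.

Lemma fpsCM x y : fpsC (x * y) = fpsC x * fpsC y.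
Proof. by rewrite /fpsC -scalerAl mul1r scalerA. Qed.

Lemma fpsCD x y : fpsC (x + y) = fpsC x + fpsC y.
Proof. exact: scalerDl. Qed.

Lemma fpsCN x : fpsC (- x) = - fpsC x.
Proof. exact: scaleNr. Qed.

End Series.

(** Adding or subtracting two equations; [ring] then checks the combination. *)
Lemma eq_of_add (A : zmodType) (x y x1 y1 x2 y2 : A) :
  x1 = y1 -> x2 = y2 -> x - y = (x1 - y1) + (x2 - y2) -> x = y.
Proof. by move=> -> ->; rewrite !subrr addr0 => /subr0_eq. Qed.

Lemma eq_of_sub (A : zmodType) (x y x1 y1 x2 y2 : A) :
  x1 = y1 -> x2 = y2 -> x - y = (x1 - y1) - (x2 - y2) -> x = y.
Proof. by move=> -> ->; rewrite !subrr => /subr0_eq. Qed.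

(** Cramer's rule for a system whose matrix has off-diagonal product
    [b0 * b1 * s ^+ 2]. *)
Lemma cramer (A : comNzRingType) (x y c s a0 a1 b0 b1 k' l' e o : A) :
  k' * l' = b0 * b1 ->
  a0 * x - b0 * (c * x) - k' * (s * y) = e ->
  a1 * y - b1 * (c * y) - l' * (s * x) = o ->
  let d := a0 * a1 - (a0 * b1 + a1 * b0) * c + b0 * b1 * ((c + s) * (c - s)) in
  x * d = e * (a1 - b1 * c) + k' * s * o /\
  y * d = o * (a0 - b0 * c) + l' * s * e.
Proof.
move=> kl <- <- d.
have -> : d = (a0 - b0 * c) * (a1 - b1 * c) - k' * l' * (s * s).
  by rewrite /d kl; ring.
by split; ring.
Qed.

(** * The recursion for the weighted sums *)

Section Recursion.
Variables (K : fieldType) (s0 s1 t0 t1 q : K).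

(** The argument of [G] is the rank of the last letter. *)
Definition word_sum (n : nat) (G : nat -> K) : K :=
  \sum_(s <- words n)
    weight s0 s1 t0 t1 s * q ^+ invW s * G (code n.-1 s`_n.-1).

(** Words of length [n + l] weighted at the indices below [n] and ascending at
    the indices [n], ..., [n + l - 1]. *)
Definition head_sum (n l : nat) : K := word_sum n (chain_sum q l n).

Definition desc_weight (i : nat) : K := if odd i then t1 else t0.
Definition asc_excess (i : nat) : K := if odd i then s1 - t1 else s0 - t0.

Lemma step_weightE i asc :
  step_weight s0 s1 t0 t1 i asc
  = desc_weight i + (if asc then asc_excess i else 0).
Proof.
rewrite /step_weight /desc_weight /asc_excess.
by case: asc; case: odd; rewrite ?addr0 // addrC subrK.
Qed.

Lemma code_ext_last n s p : signed_word n s -> (p < n.+1.*2)%N ->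
  code n (ext s p)`_n = p.
Proof.
move=> sn pn; have szs := signed_size sn.
have -> : (ext s p)`_n = entry n p by rewrite -{1}szs nth_ext_last szs.
exact: entryK.
Qed.

Lemma sum_wordsS n (F : seq int -> K) (H : seq int -> nat -> K) :
  (forall s p, signed_word n s -> (p < n.+1.*2)%N -> F (ext s p) = H s p) ->
  \sum_(s <- words n.+1) F s
  = \sum_(s <- words n) \sum_(0 <= p < n.+1.*2) H s p.
Proof.
move=> FH; rewrite wordsS big_allpairs_dep; apply: eq_big_seq => s.
rewrite mem_words => sn; rewrite /index_iota subn0; apply: eq_big_seq => p.
by rewrite mem_iota => pn; apply: FH.
Qed.

Lemma chain_sumS_if l j z : chain_sum q l.+1 j z =
  \sum_(0 <= p < (j.+1).*2)
    (if (cost j p <= z)%N then q ^+ cost j p * chain_sum q l j.+1 p else 0).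
Proof. by rewrite chain_sumS big_mkcond. Qed.

(** At the index [n.+2] the weight is [desc_weight] for both outcomes, plus
    [asc_excess] for an ascent.  In the first term the letters after this index
    are independent of the word before it. *)
Lemma head_sumS n l : head_sum n.+3 l =
  desc_weight n.+2 * word_sum n.+2 (fun=> 1) * run_sum q l.+1 n.+2
  + asc_excess n.+2 * head_sum n.+2 l.+1.
Proof.
rewrite /head_sum {1}/word_sum.
rewrite (sum_wordsS (H := fun s p => weight s0 s1 t0 t1 s * q ^+ invW s *
  (q ^+ cost n.+2 p *
   step_weight s0 s1 t0 t1 n.+2 (cost n.+2 p <= code n.+1 s`_n.+1)%N
   * chain_sum q l n.+3 p))); last first.
  move=> s p sn pn; rewrite (weight_ext _ _ _ _ _ sn) (invW_ext sn) // [_.-1]/=.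
  by rewrite (code_ext_last sn) // exprD; ring.
rewrite /word_sum mulr_sumr mulr_suml mulr_sumr -big_split.
apply: eq_bigr => s _; rewrite -mulr_sumr mulr1 run_sumS chain_sumS_if /=.
set w := weight _ _ _ _ _ * _; set x := code _ _.
set A := (X in _ * X + _); set B := (X in _ + _ * (_ * X)).
transitivity (w * (desc_weight n.+2 * A + asc_excess n.+2 * B)); last by ring.
rewrite {}/A {}/B; congr (_ * _).
rewrite !mulr_sumr -big_split; apply: eq_bigr => p _ /=.
by rewrite step_weightE; case: ifP => _; ring.
Qed.

Lemma run_sum_at0 l : run_sum q l.+1 0 = 1 + chain_sum q l 1 1.
Proof.
rewrite run_sumS big_nat_recl // big_nat1 chain_sum0 /cost /=.
by rewrite expr0 !mul1r.
Qed.

(** The two possible first letters, of ranks 0 and 1, exchange the ascent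
    conditions at -1 and 1 and hence contribute equally.  For each of them, one
    condition is an ascent from rank 1 and the other one the stronger ascent from
    rank 0. *)
Lemma head_sum2 l : head_sum 2 l =
  2 * (t1 ^+ 2 * run_sum q l.+1 1 + t1 * (s1 - t1) * run_sum q l.+2 0
       + (s1 - t1) ^+ 2).
Proof.
rewrite /head_sum /word_sum.
pose h s p := step_weight s0 s1 t0 t1 1 (cost 1 p <= code 0 (- s`_0))%N
  * step_weight s0 s1 t0 t1 1 (cost 1 p <= code 0 s`_0)%N
  * q ^+ cost 1 p * chain_sum q l 2 p.
rewrite (sum_wordsS (H := h)); last first.
  move=> s p sn pn; rewrite (weight_ext1 _ _ _ _ _ sn) (invW_ext sn) //.
  rewrite (code_ext_last sn) // exprD.
  rewrite (_ : invW s = 0%N) ?mul1r /h //.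
  by rewrite /invW (signed_size sn) big_ord1 big_ord0.
have sum_words1 (F : seq int -> K) :
    \sum_(s <- words 1) F s = F [:: 1] + F [:: -1].
  by rewrite big_cons big_seq1.
rewrite sum_words1.
have -> : \sum_(0 <= p < 2.*2) h [:: -1] p = \sum_(0 <= p < 2.*2) h [:: 1] p.
  by apply: eq_bigr => p _; rewrite /h /= opprK; congr (_ * _ * _);
    rewrite mulrC.
rewrite -mulr2n -[LHS]mulr_natl; congr (_ * _).
have -> : \sum_(0 <= p < 2.*2) h [:: 1] p
   = t1 ^+ 2 * run_sum q l.+1 1 + t1 * (s1 - t1) * chain_sum q l.+1 1 1
     + (t1 * (s1 - t1) + (s1 - t1) ^+ 2) * chain_sum q l.+1 1 0.
  rewrite run_sumS !chain_sumS_if !mulr_sumr -!big_split /=.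
  apply: eq_bigr => p _; rewrite /h !step_weightE /desc_weight /asc_excess /=.
  rewrite (_ : code 0 1 = 0%N) // (_ : code 0 (-1) = 1%N) //.
  by case: (leqP (cost 1 p) 0) => [/leqW ->|_]; [ring | case: ifP => _; ring].
by rewrite chain_sum0 run_sum_at0; ring.
Qed.

Lemma sum_words_inv n : \sum_(s <- words n) q ^+ invW s = Bcount q n.
Proof.
elim: n => [|n IHn].
  by rewrite big_seq1 /invW /Bcount !big_ord0 expr0.
rewrite (sum_wordsS (H := fun s p => q ^+ invW s * q ^+ cost n p)); last first.
  by move=> s p sn pn; rewrite (invW_ext sn) // exprD.
have := run_sum_total q 1 n; rewrite addn1 => <-.
rewrite /qfact big_nat1 /qint big_ord1 expr0 mulr1 -IHn mulr_suml.
apply: eq_bigr => s _; rewrite -mulr_sumr run_sumS; congr (_ * _).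
by apply: eq_bigr => p _; rewrite /= mulr1.
Qed.

Lemma Dcount_Bcount n : (0 < n)%N -> 2 * Dcount n q = Bcount q n.
Proof.
move=> n0; rewrite -sum_words_inv sum_Dgroup //; last first.
  by move=> s sn; rewrite (invW_flip1 sn).
by congr (_ * _); apply: eq_bigr => w _; rewrite invD_window.
Qed.

Lemma Dpoly_word_sum n : (0 < n)%N ->
  2 * Dpoly n s0 s1 t0 t1 q = word_sum n (fun=> 1).
Proof.
move=> n0; rewrite /word_sum sum_Dgroup //; last first.
  by move=> s sn; rewrite (invW_flip1 sn) (weight_flip1 _ _ _ _ sn) !mulr1.
congr (_ * _); apply: eq_bigr => w; rewrite inE => /andP[wB _].
by rewrite weight_window // invD_window mulr1.
Qed.

Lemma Dcount0 : Dcount 0 q = 1.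
Proof.
rewrite /Dcount.
have e (w : {perm signed 0}) : window w = [::].
  by apply: size0nil; rewrite size_window.
rewrite (eq_bigr (fun=> 1)) => [|w _]; last first.
  by rewrite invD_window e /invW big_ord0.
rewrite (eq_bigl (pred1 (1%g : {perm signed 0}))) ?big_pred1_eq // => w.
have -> : w = 1%g by apply/permP => -[[]].
rewrite /= eqxx !inE e /= andbT; apply/forallP => -[[]] //.
Qed.

Variable m : K.
Hypothesis two_neq0 : (2 : K) != 0.
Hypothesis qint_neq0 : forall j : nat, (0 < j)%N -> qint j q != 0.
Hypothesis a_neq0 : s0 - t0 != 0.
Hypothesis b_neq0 : s1 - t1 != 0.
Hypothesis mE : m ^+ 2 = (s0 - t0) * (s1 - t1).

Lemma m_neq0 : m != 0.
Proof. by rewrite -sqrf_eq0 mE mulf_neq0. Qed.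

(** For positive [i], [1 + q ^+ i] divides the [q]-integer of [2 i]. *)
Lemma expr_add1_neq0 i : 1 + q ^+ i != 0.
Proof.
case: i => [|i]; first by rewrite expr0 -mulr2n.
have := qint_neq0 (isT : 0 < i.+1 + i.+1)%N; rewrite qintD.
by apply: contraNneq => qi; rewrite -{1}[qint _ _]mul1r -mulrDl qi mul0r.
Qed.

Lemma qfact_neq0 n : qfact n q != 0.
Proof.
elim: n => [|n IHn]; first by rewrite /qfact big_geq // oner_neq0.
by rewrite qfactS mulf_neq0 // qint_neq0.
Qed.

Lemma Bcount_neq0 n : Bcount q n != 0.
Proof.
by apply/prodf_neq0 => i _; rewrite mulf_neq0 ?expr_add1_neq0 ?qint_neq0.
Qed.

Lemma run_sumE l j :
  run_sum q l j = Bcount q (j + l) / (Bcount q j * qfact l q).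
Proof.
rewrite -run_sum_total; have := Bcount_neq0 j; have := qfact_neq0 l.
by move=> f0 B0; field; rewrite f0 B0.
Qed.

Lemma DcountE n : (0 < n)%N -> Dcount n q = Bcount q n / 2.
Proof. by move=> /(Dcount_Bcount) <-; rewrite mulrC mulKf. Qed.

Lemma Dcount1 : Dcount 1 q = 1.
Proof.
rewrite DcountE // /Bcount big_ord1 /qint big_ord1 expr0 mul1r.
by rewrite -mulr2n divff.
Qed.

Definition Dratio (n : nat) : K := Dpoly n s0 s1 t0 t1 q / Dcount n q.

Lemma DratioE n : (0 < n)%N ->
  Dratio n = word_sum n (fun=> 1) / Bcount q n.
Proof.
move=> n0; rewrite /Dratio DcountE // -Dpoly_word_sum //.
by rewrite invf_div mulrCA mulrA.
Qed.

Definition head_ratio (n l : nat) : K := head_sum n l / Bcount q (n + l).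

Lemma head_ratioS n l : head_ratio n.+3 l =
  desc_weight n.+2 * Dratio n.+2 / qfact l.+1 q
  + asc_excess n.+2 * head_ratio n.+2 l.+1.
Proof.
rewrite /head_ratio head_sumS DratioE // run_sumE -addSnnS.
have := Bcount_neq0 (n.+3 + l); have := Bcount_neq0 n.+2.
have := qfact_neq0 l.+1.
set B := Bcount _ _; set B' := Bcount _ _; set f := qfact _ _ => f0 B0 B'0.
by field; rewrite f0 B0 B'0.
Qed.

Lemma head_ratio2 l : head_ratio 2 l =
  t1 ^+ 2 / qfact l.+1 q + 2 * t1 * (s1 - t1) / qfact l.+2 q
  + (s1 - t1) ^+ 2 / Dcount l.+2 q.
Proof.
rewrite /head_ratio head_sum2 DcountE // !run_sumE.
have -> : Bcount q 0 = 1 by rewrite /Bcount big_ord0.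
have -> : Bcount q 1 = 2.
  by have := Dcount_Bcount (isT : 0 < 1)%N; rewrite Dcount1 mulr1.
rewrite add1n add0n add2n.
have := Bcount_neq0 l.+2; have := qfact_neq0 l.+1; have := qfact_neq0 l.+2.
set B := Bcount _ _; set f := qfact _ _; set f' := qfact _ _ => f0 f'0 B0.
by field; rewrite two_neq0 f0 f'0 B0.
Qed.

(** As [m] is the geometric mean of the two values of [asc_excess], the product
    of its values over [n] consecutive indices from 2 on is [m ^+ n] times this
    factor, by [parity_factorS]. *)
Definition parity_factor (n : nat) : K := if odd n then (s0 - t0) / m else 1.

Lemma parity_factor_neq0 n : parity_factor n != 0.
Proof.
rewrite /parity_factor; case: ifP => _; rewrite ?oner_neq0 //.
by rewrite mulf_neq0 ?invr_neq0 ?m_neq0.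
Qed.

Lemma parity_factorS n :
  asc_excess n.+2 * parity_factor n = parity_factor n.+1 * m.
Proof.
have m0 := m_neq0.
rewrite /asc_excess /parity_factor /= negbK; case: odd => /=.
  by rewrite mul1r mulrA [_ * (s0 - t0)]mulrC -mE expr2 mulfK.
by rewrite mulr1 divfK.
Qed.

(** Divided by [parity_factor n * m ^+ n], the recursion [head_ratioS] is a
    telescoping sum. *)
Lemma head_ratio_sum n l : head_ratio n.+2 l =
  parity_factor n * m ^+ n *
  (\sum_(k < n) desc_weight k.+2 * Dratio k.+2 /
     (m ^+ k.+1 * parity_factor k.+1 * qfact (n + l - k) q)
   + head_ratio 2 (n + l)).
Proof.
elim: n l => [|n IHn] l.
  by rewrite big_ord0 /parity_factor expr0 !mul1r add0r.
rewrite head_ratioS IHn addnS big_ord_recr /= addSn.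
have -> : ((n + l).+1 - n = l.+1)%N by lia.
have -> : asc_excess n.+2 = parity_factor n.+1 * m / parity_factor n.
  by rewrite -parity_factorS mulfK ?parity_factor_neq0.
have := parity_factor_neq0 n.+1; have := parity_factor_neq0 n.
have := qfact_neq0 l.+1; have := expf_neq0 n m_neq0; have := m_neq0.
rewrite !exprS; set M := m ^+ n; set f := qfact _ _.
set p := parity_factor n; set p' := parity_factor n.+1.
set S := \sum_(_ < _) _; set h := head_ratio 2 _ => m0 M0 f0 p0 p'0.
by field; rewrite m0 M0 f0 p0 p'0.
Qed.

Lemma Dratio_sum n : Dratio n.+2 = parity_factor n *
  (\sum_(k < n) desc_weight k.+2 / (m * parity_factor k.+1) * Dratio k.+2
      * (m ^+ (n - k) / qfact (n - k) q)
   + m ^+ n * head_ratio 2 n).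
Proof.
have -> : Dratio n.+2 = head_ratio n.+2 0.
  by rewrite DratioE // /head_ratio addn0.
rewrite head_ratio_sum addn0 -mulrA mulrDr; congr (_ * (_ + _)).
rewrite mulr_sumr; apply: eq_bigr => k _.
rewrite -{1}(subnK (ltnW (ltn_ord k))) exprD exprS.
have := parity_factor_neq0 k.+1; have := qfact_neq0 (n - k).
have := expf_neq0 k m_neq0; have := m_neq0; move: (m ^+ (n - k)) => M'.
set M := _ ^+ _; set f := qfact _ _; set p := parity_factor _ => m0 M0 f0 p0.
by field; rewrite m0 M0 f0 p0.
Qed.

Let D0 := Dgf0 s0 s1 t0 t1 q.
Let D1 := Dgf1 s0 s1 t0 t1 q.

(** The contribution of the words without a free index beyond 1, collected from
    [head_ratio2]; the subtracted terms are those of degree 0 and 1. *)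
Definition base_series (c k : K) : fps K :=
  (k * t1) *: (fpsX * (e_q q c - 1))
  + (2 * t1) *: (e_q q c - 1 - c *: fpsX)
  + (s1 - t1) *: (exp_D q c - 1 - c *: fpsX).

Lemma qfact0 : qfact 0 q = 1.
Proof. by rewrite /qfact big_geq. Qed.

Lemma qfact1 : qfact 1 q = 1.
Proof. by rewrite qfactS qfact0 mul1r /qint big_ord1 expr0. Qed.

Lemma fcoef_D0 n : fcoef D0 n.+2 = if odd n then 0 else Dratio n.+2.
Proof. by rewrite /D0 /= negbK; case: odd. Qed.

Lemma fcoef_D1 n : fcoef D1 n.+2 = if odd n then Dratio n.+2 else 0.
Proof. by rewrite /D1 /= negbK; case: n => // n; case: odd. Qed.

Let k := (s0 - t0) * t1 / m.

(** [Dratio_sum] as a convolution.  Both parities fit into a single product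
    because the factor [parity_factor k.+1] can be absorbed into the coefficients
    of [D0] and [D1]. *)
Lemma series_eq :
  (s0 - t0) *: D0 + m *: D1
  = (t0 *: D0 + k *: D1) * (e_q q m - 1) + base_series m k.
Proof.
have m0 := m_neq0; apply/fpsP; case=> [|[|n]].
- rewrite /base_series !fcoef_simp fcoefM big_ord1 !fcoef_simp.
  have [-> ->] : fcoef D0 0 = 0 /\ fcoef D1 0 = 0 by [].
  by rewrite qfact0 Dcount0 expr0 divr1 !(mulr0, subr0, subrr, addr0, mul0r).
- rewrite /base_series !fcoef_simp fcoefM 2!big_ord_recl big_ord0 !fcoef_simp.
  have [-> [-> [-> ->]]] : fcoef D0 0 = 0 /\ fcoef D1 0 = 0 /\
    fcoef D0 (lift ord0 ord0 : 'I_2) = 0 /\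
    fcoef D1 (lift ord0 ord0 : 'I_2) = 0.
    by [].
  rewrite qfact0 qfact1 Dcount1 expr0 expr1 !divr1 mulr1.
  by rewrite !(mulr0, subr0, subrr, addr0, mul0r).
rewrite fcoefD !fcoefZ fcoef_D0 fcoef_D1.
transitivity ((s0 - t0) * (Dratio n.+2 / parity_factor n)).
  rewrite /parity_factor; case: odd; rewrite ?mulr0 ?addr0 ?divr1 //.
  by rewrite add0r invf_div; field; rewrite a_neq0.
rewrite Dratio_sum [_ / parity_factor n]mulrC mulKf ?parity_factor_neq0 //.
rewrite fcoefD.
rewrite mulrDr; congr (_ + _).
  rewrite fcoefM_shift2; first last.
  - by rewrite !fcoef_simp qfact0 expr0 divr1 subrr.
  - by rewrite !fcoef_simp !mulr0 addr0.
  - by rewrite !fcoef_simp !mulr0 addr0.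
  rewrite mulr_sumr; apply: eq_bigr => i _.
  rewrite !fcoef_simp fcoef_D0 fcoef_D1.
  rewrite [_ == _]gtn_eqF ?subn_gt0 // subr0 mulrA; congr (_ * _).
  rewrite /desc_weight /parity_factor /k /= negbK; case: odd => /=.
    by rewrite mulr1 mulr0 add0r !mulrA.
  by rewrite mulr0 addr0; field; rewrite m0 a_neq0.
rewrite /base_series !fcoef_simp head_ratio2 /= !subr0 !mulr0 !subr0 /k.
have -> : m ^+ n.+2 = m ^+ n * ((s0 - t0) * (s1 - t1)).
  by rewrite -mE -exprD addn2.
rewrite [m ^+ n.+1]exprS (DcountE (n := n.+2)) //.
have := qfact_neq0 n.+1; have := qfact_neq0 n.+2; have := Bcount_neq0 n.+2.
set B := Bcount _ _; set f := qfact _ _; set f' := qfact _ _; set M := m ^+ n.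
by move=> B0 f0 f'0; field; rewrite m0 B0 f0 f'0 two_neq0.
Qed.

Lemma fps_flip_D0 : fps_flip D0 = D0.
Proof.
apply/fpsP => n; rewrite /D0 /=; case: ifP; rewrite ?mulr0 //.
by move=> /andP[_ /negbTE odd_n]; rewrite -signr_odd odd_n mul1r.
Qed.

Lemma fps_flip_D1 : fps_flip D1 = - D1.
Proof.
apply/fpsP => n; rewrite /D1 /=; case: ifP; rewrite ?mulr0 ?oppr0 //.
by move=> /andP[_ odd_n]; rewrite -signr_odd odd_n expr1 mulN1r.
Qed.

Definition fps_flipE := (fps_flipD, fps_flipN, fps_flipZ, fps_flipM, fps_flip1,
  fps_flipX, fps_flip_eq, fps_flip_expD, fps_flip_D0, fps_flip_D1).

Lemma base_series_flip : fps_flip (base_series m k) = base_series (- m) (- k).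
Proof. by rewrite /base_series !fps_flipE !(mulNr, scalerN, scaleNr). Qed.

Lemma series_eq_flip :
  (s0 - t0) *: D0 - m *: D1
  = (t0 *: D0 - k *: D1) * (e_q q (- m) - 1) + base_series (- m) (- k).
Proof.
have /(congr1 (@fps_flip K)) := series_eq.
rewrite fps_flipD [in X in _ = X]fps_flipD base_series_flip.
by rewrite !fps_flipE !scalerN.
Qed.

Lemma fps_double_inj (f g : fps K) : f + f = g + g -> f = g.
Proof.
move=> fg; apply/fpsP => n; have /(congr1 (fun h => fcoef h n)) := fg.
rewrite !fcoefD -!mulr2n -[_ *+ 2]mulr_natl -[RHS]mulr_natl.
exact: mulfI two_neq0 _ _.
Qed.

Lemma half_sumE (f g : fps K) : f = 2^-1 *: (f + g) + 2^-1 *: (f - g).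
Proof.
apply: fps_double_inj; apply/fpsP => n; rewrite !fcoef_simp.
by field; rewrite two_neq0.
Qed.

Lemma half_subE (f g : fps K) : g = 2^-1 *: (f + g) - 2^-1 *: (f - g).
Proof.
apply: fps_double_inj; apply/fpsP => n; rewrite !fcoef_simp.
by field; rewrite two_neq0.
Qed.

Lemma e_qE : e_q q m = cosh_q q m + sinh_q q m.
Proof. exact: half_sumE. Qed.

Lemma e_qNE : e_q q (- m) = cosh_q q m - sinh_q q m.
Proof. exact: half_subE. Qed.

Lemma exp_DE : exp_D q m = cosh_D q m + sinh_D q m.
Proof. exact: half_sumE. Qed.

Lemma exp_DNE : exp_D q (- m) = cosh_D q m - sinh_D q m.
Proof. exact: half_subE. Qed.

Lemma even_system :
  s0 *: D0 - t0 *: (cosh_q q m * D0) - k *: (sinh_q q m * D1)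
  = (2 * t1) *: (cosh_q q m - 1)
    + (k * t1) *: (fpsX * sinh_q q m)
    + (s1 - t1) *: (cosh_D q m - 1).
Proof.
have := series_eq_flip; have := series_eq.
rewrite /base_series e_qE e_qNE exp_DE exp_DNE !scaleC !(fpsCM, fpsCD, fpsCN).
set c := cosh_q _ _; set s := sinh_q _ _.
set cD := cosh_D _ _; set sD := sinh_D _ _.
move=> e1 e2; apply: fps_double_inj; apply: (eq_of_add e1 e2); ring.
Qed.

Lemma odd_system_raw :
  m *: D1 - t0 *: (sinh_q q m * D0) - k *: ((cosh_q q m - 1) * D1)
  = (k * t1) *: (fpsX * (cosh_q q m - 1))
    + (2 * t1) *: (sinh_q q m - m *: fpsX)
    + (s1 - t1) *: (sinh_D q m - m *: fpsX).
Proof.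
have := series_eq_flip; have := series_eq.
rewrite /base_series e_qE e_qNE exp_DE exp_DNE !scaleC !(fpsCM, fpsCD, fpsCN).
set c := cosh_q _ _; set s := sinh_q _ _.
set cD := cosh_D _ _; set sD := sinh_D _ _.
move=> e1 e2; apply: fps_double_inj; apply: (eq_of_sub e1 e2); ring.
Qed.

Let l := (s1 - t1) * t0 / m.

Lemma odd_system :
  s1 *: D1 - t1 *: (cosh_q q m * D1) - l *: (sinh_q q m * D0)
  = t1 ^+ 2 *: (fpsX * (cosh_q q m - 1))
    + (2 * t1 * (s1 - t1) / m) *: (sinh_q q m - m *: fpsX)
    + ((s1 - t1) ^+ 2 / m) *: (sinh_D q m - m *: fpsX).
Proof.
have m0 := m_neq0.
have mm : (s1 - t1) / m * k = t1.
  rewrite /k [(s0 - t0) * t1]mulrC mulf_div [(s1 - t1) * _]mulrC.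
  rewrite -mulrA -mE -expr2.
  by rewrite mulfK // expf_neq0.
have := congr1 (fun f => ((s1 - t1) / m) *: f) odd_system_raw.
rewrite !(scalerBr, scalerDr) !scalerA divfK // mm.
rewrite [_ * (k * t1)]mulrA mm -expr2.
have -> : (s1 - t1) / m * t0 = l by rewrite /l mulrAC.
have -> : (s1 - t1) / m * (2 * t1) = 2 * t1 * (s1 - t1) / m.
  by rewrite mulrC !mulrA.
have -> : (s1 - t1) / m * (s1 - t1) = (s1 - t1) ^+ 2 / m.
  by rewrite mulrAC expr2.
move=> <-.
rewrite !scaleC fpsCD fpsCN; ring.
Qed.

End Recursion.

Theorem theorem33 (K : fieldType) (s0 s1 t0 t1 q rs0 rs1 m : K)
  (two_neq0 : (2 : K) != 0)
  (qint_neq0 : forall j : nat, (0 < j)%N -> qint j q != 0)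
  (s0_neq0 : s0 != 0) (s1_neq0 : s1 != 0)
  (s0_neq_t0 : s0 != t0) (s1_neq_t1 : s1 != t1)
  (rs0E : rs0 ^+ 2 = s0) (rs1E : rs1 ^+ 2 = s1)
  (mE : m ^+ 2 = (s0 - t0) * (s1 - t1)) :
  let u : fps K := fpsX in
  let rs01 := rs0 * rs1 in
  let TOD : fps K :=
    (rs01 * t1 ^+ 2 / s1 ^+ 2) *: (u * (cosh_q q m - 1))
    + ((s1 - t1) * m * s0 / ((s0 - t0) * s1 * rs01)) *: (sinh_D q m - m *: u)
    + (2 * t1 * (s1 - t1) * rs01 / (s1 ^+ 2 * m)) *: (sinh_q q m - m *: u) in
  let TED : fps K :=
    (2 * t1 / s1) *: (cosh_q q m - 1)
    + (t1 ^+ 2 * (s0 - t0) * rs01 ^+ 2 / (s1 ^+ 2 * s0 * m)) *: (u * sinh_q q m)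
    + ((s1 - t1) / s1) *: (cosh_D q m - 1) in
  let den : fps K :=
    (s0 * s1)%:A - (s0 * t1 + s1 * t0) *: cosh_q q m
    + (t0 * t1) *: (e_q q m * e_q q (- m)) in
  Dgf0 s0 s1 t0 t1 q =
    (s1 *: (TED * (s1%:A - t1 *: cosh_q q m))
     + TOD * ((s1 * t1 * (s0 - t0) * rs01 / (m * s0)) *: sinh_q q m)) / den /\
  Dgf1 s0 s1 t0 t1 q =
    ((s1 * rs1 / rs0) *: (TOD * (s0%:A - t0 *: cosh_q q m))
     + TED * ((s1 * t0 * (s1 - t1) / m) *: sinh_q q m)) / den.
Proof.
have a_neq0 : s0 - t0 != 0 by rewrite subr_eq0.
have b_neq0 : s1 - t1 != 0 by rewrite subr_eq0.
have m0 : m != 0 by apply: m_neq0 a_neq0 b_neq0 mE.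
have r00 : rs0 != 0 by rewrite -sqrf_eq0 rs0E.
have r10 : rs1 != 0 by rewrite -sqrf_eq0 rs1E.
move=> u rs01 TOD TED den.
have evenE := even_system two_neq0 qint_neq0 a_neq0 b_neq0 mE.
have oddE := odd_system two_neq0 qint_neq0 a_neq0 b_neq0 mE.
set k := (s0 - t0) * t1 / m in evenE; set l := (s1 - t1) * t0 / m in oddE.
set D0 := Dgf0 s0 s1 t0 t1 q in evenE oddE *.
set D1 := Dgf1 s0 s1 t0 t1 q in evenE oddE *.
have TED_E : s1 *: TED
    = s0 *: D0 - t0 *: (cosh_q q m * D0) - k *: (sinh_q q m * D1).
  rewrite evenE /TED 2!scalerDr !scalerA -/u.
  congr (_ *: _ + _ *: _ + _ *: _).
  - by field; rewrite s1_neq0.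
  - by rewrite /k /rs01 exprMn rs0E rs1E; field; rewrite m0 s0_neq0 s1_neq0.
  - by field; rewrite s1_neq0.
(* Equal to [s1 * rs01 / s0], the factor that turns [TOD] into the right-hand
   side of [odd_system]. *)
pose r := s1 * rs1 / rs0.
have TOD_E : r *: TOD
    = s1 *: D1 - t1 *: (cosh_q q m * D1) - l *: (sinh_q q m * D0).
  rewrite oddE [RHS]addrAC /TOD 2!scalerDr !scalerA -/u /r /rs01.
  congr (_ *: _ + _ *: _ + _ *: _).
  - by rewrite -rs1E; field; rewrite r00 r10.
  - have -> : (s1 - t1) ^+ 2 / m = (s1 - t1) * m / (s0 - t0).
      apply/eqP; rewrite eqr_div // -[_ * m * m]mulrA -expr2 mE.
      by apply/eqP; ring.
    move: a_neq0; rewrite -rs0E -rs1E => a_neq0.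
    by field; rewrite r00 r10 a_neq0.
  - by rewrite -rs1E; field; rewrite r00 r10 m0.
have den_unit : den \is a GRing.unit.
  have fcoefM0 (f g : fps K) : fcoef (f * g) 0 = fcoef f 0 * fcoef g 0.
    by rewrite fcoefM big_ord1.
  have e0 c : fcoef (e_q q c) 0 = 1 by rewrite fcoefE qfact0 expr0 divr1.
  have c0 : fcoef (cosh_q q m) 0 = 1.
    by rewrite fcoefZ fcoefD !e0 mulVf.
  have den0 : fcoef den 0 = (s0 - t0) * (s1 - t1).
    rewrite /den 2!fcoefD fcoefN 2!fcoefZ c0 fcoefZ fcoefM0 !e0 fcoef1 /=; ring.
  have : fcoef den 0 != 0 by rewrite den0 mulf_neq0.
  exact.
have kl : fpsC k * fpsC l = fpsC t0 * fpsC t1.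
  rewrite -!fpsCM /k /l mulf_div -expr2 mE; congr fpsC.
  by field; rewrite a_neq0 b_neq0.
have denE : den = fpsC s0 * fpsC s1 - (fpsC s0 * fpsC t1 + fpsC s1 * fpsC t0) *
    cosh_q q m + fpsC t0 * fpsC t1 *
    ((cosh_q q m + sinh_q q m) * (cosh_q q m - sinh_q q m)).
  by rewrite /den e_qE // e_qNE // !scaleC mulr1 !(fpsCM, fpsCD).
rewrite !scaleC in TED_E TOD_E.
have [] := cramer kl (esym TED_E) (esym TOD_E); rewrite -denE => e0 e1.
clearbody TED TOD.
split; apply: (mulIr den_unit); rewrite divrK // ?e0 ?e1.
  rewrite (_ : s1 * t1 * (s0 - t0) * rs01 / (m * s0) = k * r).
    by rewrite !scaleC mulr1 fpsCM; ring.
  by rewrite /k /r /rs01 -rs0E; field; rewrite m0 r00.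
rewrite (_ : s1 * t0 * (s1 - t1) / m = l * s1); last by rewrite /l; ring.
by rewrite -/r !scaleC mulr1 (fpsCM l); ring.
Qed.
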